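(* Let $\mathbb{F}$ be a field with $\operatorname{char}(\mathbb{F})\neq 2$, let $n\geq 2$, and let $L_n$ be the left Leibniz algebra over $\mathbb{F}$ with basis $\mathcal{B}_n=\{e_1,e_2,f_3,\ldots,f_n\}$ whose only non-zero bracket of basis elements is $[e_2,e_1]=e_1$. (i) A derivation of $L_n$ is represented, with respect to the basis $\mathcal{B}_n$, by a matrix of the form $$\begin{pmatrix} \alpha & 0 & 0\\ 0 & 0 & 0\\ 0 & a & A\end{pmatrix},$$ where $\alpha\in\mathbb{F}$, $a=(a_3,\ldots,a_n)^{T}\in\mathbb{F}^{n-2}$ is a column vector and $A\in \operatorname{M}_{n-2}(\mathbb{F})$. (ii) The group of automorphisms $\operatorname{Aut}(L_n)$ is the Lie subgroup of $\operatorname{GL}_n(\mathbb{F})$ of matrices of the form $$\begin{pmatrix} \beta & 0 & 0\\ 0 & 1 & 0\\ 0 & b & B\end{pmatrix},$$ where $\beta\in\mathbb{F}$, $\beta\neq 0$, $b=(b_3,\ldots,b_n)^{T}\in\mathbb{F}^{n-2}$ is a column vector and $B\in\operatorname{GL}_{n-2}(\mathbb{F})$. (iii) The Leibniz algebra of biderivations of $L_n$ consists of the pairs $(d,D)$ of linear endomorphisms of $L_n$ which are represented by the pair of matrices $$\left(\begin{pmatrix} \alpha & 0 & 0\\ 0 & 0 & 0\\ 0 & a & A\end{pmatrix},\ \begin{pmatrix} 0 & \alpha' & 0\\ 0 & 0 & 0\\ 0 & a' & A'\end{pmatrix}\right),$$ where $\alpha,\alpha'\in\mathbb{F}$, $a=(a_3,\ldots,a_n)^{T}$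 and $a'=(a'_3,\ldots,a'_n)^{T}$ are column vectors in $\mathbb{F}^{n-2}$, and $A,A'\in\operatorname{M}_{n-2}(\mathbb{F})$.
   Context: A left Leibniz algebra over $\mathbb{F}$ is an $\mathbb{F}$-vector space $L$ with a bilinear map $[-,-]\colon L\times L\to L$ such that $[x,[y,z]]=[[x,y],z]+[y,[x,z]]$ for all $x,y,z\in L$. A derivation of $L$ is a linear map $d\colon L\to L$ with $d([x,y])=[d(x),y]+[x,d(y)]$ for all $x,y\in L$. An anti-derivation of $L$ is a linear map $D\colon L\to L$ with $D([x,y])=[x,D(y)]-[y,D(x)]$ for all $x,y\in L$. A biderivation of $L$ is a pair $(d,D)$ with $d$ a derivation and $D$ an anti-derivation such that $[d(x)+D(x),y]=0$ for all $x,y\in L$. The set of all biderivations of $L$ is a Leibniz algebra with bracket $[(d,D),(d',D')]=(d\circ d'-d'\circ d,\ d\circ D'-D'\circ d)$. $\operatorname{Aut}(L)$ is the group of bijective linear maps $\varphi\colon L\to L$ with $\varphi([x,y])=[\varphi(x),\varphi(y)]$ for all $x,y\in L$. $\operatorname{M}_{n-2}(\mathbb{F})$ is the space of $(n-2)\times(n-2)$ matrices over $\mathbb{F}$, and $\operatorname{GL}_m(\mathbb{F})$ is the group of invertible $m\times m$ matrices over $\mathbb{F}$. Matrices act on coordinate column vectors, so the columns of a matrix are the coordinates of the images of $e_1,e_2,f_3,\ldots,f_n$ in this order. All displayed matrices are $n\times n$ block matrices with row and column blocks of sizes $1,1,n-2$, and $0$ denotes a zero block of the appropriate size. *)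

(* Defs.v *)
From HB Require Import structures.
From mathcomp Require Import all_boot all_order all_algebra.
From mathcomp Require Import mpoly.

Set Implicit Arguments.
Unset Strict Implicit.
Unset Printing Implicit Defensive.

Import GRing.Theory.
Local Open Scope ring_scope.

(* The carrier is a subset S of an ambient vector space V, so that the notion
   applies both to a whole space (S = fun _ => True) and to the set of
   biderivations inside End(L) x End(L); br is only constrained on S. *)
Definition left_leibniz_on (F : fieldType) (V : lmodType F)
    (S : V -> Prop) (br : V -> V -> V) : Prop :=
  [/\ S 0 /\ (forall (c : F) x y, S x -> S y -> S (c *: x + y)),
      forall x y, S x -> S y -> S (br x y),
      forall (c : F) x y z, S x -> S y -> S z ->
        br (c *: x + y) z = c *: br x z + br y z /\
        br z (c *: x + y) = c *: br z x + br z y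
    & forall x y z, S x -> S y -> S z ->
        br x (br y z) = br (br x y) z + br y (br x z)].

Section Leibniz.
Variables (F : fieldType) (L : vectType F) (br : L -> L -> L).

Definition left_leibniz : Prop := left_leibniz_on (fun _ : L => True) br.

Definition derivation (d : 'End(L)) : Prop :=
  forall x y, d (br x y) = br (d x) y + br x (d y).

Definition antiderivation (D : 'End(L)) : Prop :=
  forall x y, D (br x y) = br x (D y) - br y (D x).

Definition biderivation (p : ('End(L) * 'End(L))%type) : Prop :=
  [/\ derivation p.1, antiderivation p.2
    & forall x y, br (p.1 x + p.2 x) y = 0].

Definition bider_bracket (p q : ('End(L) * 'End(L))%type) :
    ('End(L) * 'End(L))%type :=
  ((p.1 \o q.1)%VF - (q.1 \o p.1)%VF, (p.1 \o q.2)%VF - (q.2 \o p.1)%VF).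

Definition automorphism (phi : 'End(L)) : Prop :=
  bijective phi /\ forall x y, phi (br x y) = br (phi x) (phi y).

(* With 0-based indices, B = (e_1, e_2, f_3, ..., f_n) has e_1 = B`_0,
   e_2 = B`_1 and f_k = B`_k.-1. *)
Definition is_Ln (n : nat) (B : n.-tuple L) : Prop :=
  [/\ left_leibniz, basis_of fullv B, br B`_1 B`_0 = B`_0
    & forall i j : 'I_n, ((i : nat), (j : nat)) <> (1%N, 0%N) ->
        br B`_i B`_j = 0].

End Leibniz.

(* Column convention: column j holds the coordinates of f(B`_j).  (The
   library's mxof acts on row vectors and is the transpose.) *)
Definition mx_of (F : fieldType) (L : vectType F) (n : nat) (B : n.-tuple L)
    (f : 'End(L)) : 'M[F]_n :=
  \matrix_(i, j) coord B i (f B`_j).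

Lemma blocks112 (n : nat) (hn : (2 <= n)%N) : (1 + (1 + n.-2))%N = n.
Proof. by case: n hn => [|[|n]]. Qed.

(* All the displayed matrices have zero last entries in their first two rows
   and a zero first entry in the bottom block row:
     / p q 0 \
     | 0 s 0 |
     \ 0 c C /                                                              *)
Definition block3 (F : fieldType) (n : nat) (hn : (2 <= n)%N)
    (p q s : F) (c : 'cV[F]_(n.-2)) (C : 'M[F]_(n.-2)) : 'M[F]_n :=
  castmx (blocks112 hn, blocks112 hn)
    (block_mx (p%:M : 'M_1) (row_mx (q%:M : 'M_1) 0)
              0             (block_mx (s%:M : 'M_1) 0
                                      c             C)).

Definition GL_subgroup (F : fieldType) (n : nat) (G : 'M[F]_n -> Prop) : Prop :=
  [/\ forall M, G M -> M \in unitmx,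
      G 1%:M,
      forall M N, G M -> G N -> G (M *m N)
    & forall M, G M -> G (invmx M)].

(* Over an arbitrary field there is no manifold structure on GL_n(F); "Lie
   subgroup" is rendered algebraically: a subgroup that is cut out of GL_n(F)
   by polynomial equations P_1 = ... = P_r = 0 in the matrix entries whose
   differentials are linearly independent at every point of the subgroup.
   Over R, C, or any complete valued field, the implicit function theorem
   makes such a subgroup a closed embedded Lie subgroup of GL_n(F). *)
Definition lie_subgroup (F : fieldType) (n : nat) (G : 'M[F]_n -> Prop) : Prop :=
  GL_subgroup G /\
  exists (r : nat) (P : 'I_r -> {mpoly F[n * n]}),
    (forall M, M \in unitmx ->
       (G M <-> forall k, (P k).@[fun l => mxvec M 0 l] = 0)) /\
    (forall M, G M ->
       row_free (\matrix_(k < r, l < n * n)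
                   ((P k)^`M(l)).@[fun l' => mxvec M 0 l'])).

Definition aut_mx (F : fieldType) (L : vectType F) (br : L -> L -> L)
    (n : nat) (B : n.-tuple L) (M : 'M[F]_n) : Prop :=
  exists2 phi : 'End(L), automorphism br phi & mx_of B phi = M.

(* Main.v *)
(* Bilinearity gives [x, y] = x_2 y_1 e_1, where x_2 and y_1 are coordinates.
   For each kind of map f the defining identity therefore becomes a scalar
   identity between the first two coordinates of f; evaluating it at e_1 and
   e_2 fixes the first two rows and the first column of the matrix of f, and
   conversely these entries already imply the identity.  The other entries are
   free, up to invertibility.  In particular Aut(L_n) is cut out of GL_n by
   equations fixing single matrix entries. *)

From HB Require Import structures.
Require Import Defs.
From mathcomp Require Import all_boot all_order all_algebra.
From mathcomp Require Import mpoly ring.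

Set Implicit Arguments.
Unset Strict Implicit.
Unset Printing Implicit Defensive.

Import GRing.Theory.
Local Open Scope ring_scope.

(** * Block matrices with block sizes 1, 1, n-2 *)

Lemma block3E (F : fieldType) (m : nat) (hm : (2 <= m.+2)%N) (p q s : F) c C :
  block3 hm p q s c C =
    block_mx (p%:M : 'M_1) (row_mx (q%:M : 'M_1) 0)
             0             (block_mx (s%:M : 'M_1) 0 c C).
Proof. exact: (@castmx_id F m.+2 m.+2). Qed.

(** The blocks [c] and [C] are free, so having this shape constrains only the first two rows and the
    first column. A boolean exponent in [p *+ (j == o0)] acts as an indicator. *)
Lemma block_mx112P (F : fieldType) (m : nat) (p q s : F)
    (M : 'M[F]_(1 + (1 + m))) :
  let o0 := lshift (1 + m) (ord0 : 'I_1) in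
  let o1 := rshift 1 (lshift m (ord0 : 'I_1)) in
  (exists c C, M = block_mx (p%:M : 'M_1) (row_mx (q%:M : 'M_1) 0)
                            0 (block_mx (s%:M : 'M_1) 0 c C)) <->
  [/\ forall j, M o0 j = p *+ (j == o0) + q *+ (j == o1),
      forall j, M o1 j = s *+ (j == o1)
    & forall i, M i o0 = p *+ (i == o0)].
Proof.
move=> o0 o1; split=> [[c [C ->]]|[M0 M1 Mc]].
  split=> i; case: (split_ordP i) => {}i ->.
  - by rewrite block_mxEul !ord1 mxE eqxx eq_lrshift addr0.
  - rewrite block_mxEur eq_rlshift add0r (inj_eq (@rshift_inj _ _)).
    case: (split_ordP i) => {}i ->; first by rewrite row_mxEl !ord1 mxE eqxx.
    by rewrite row_mxEr eq_rlshift mxE.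
  - by rewrite block_mxEdl mxE eq_lrshift.
  - rewrite block_mxEdr (inj_eq (@rshift_inj _ _)).
    case: (split_ordP i) => {}i ->; first by rewrite block_mxEul !ord1 mxE eqxx.
    by rewrite block_mxEur eq_rlshift mxE.
  - by rewrite block_mxEul !ord1 mxE eqxx.
  - by rewrite block_mxEdl eq_rlshift mxE.
exists (\col_i M (rshift 1 (rshift 1 i)) o1), (drsubmx (drsubmx M)).
apply/matrixP=> i j; case: (split_ordP i) => {}i ->; case: (split_ordP j) => {}j ->.
- by rewrite block_mxEul !ord1 Mc mxE eqxx.
- rewrite block_mxEur !ord1 M0 eq_rlshift add0r (inj_eq (@rshift_inj _ _)).
  case: (split_ordP j) => {}j ->; first by rewrite row_mxEl !ord1 mxE eqxx.
  by rewrite row_mxEr eq_rlshift mxE.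
- by rewrite block_mxEdl !ord1 Mc eq_rlshift mxE.
- rewrite block_mxEdr.
  case: (split_ordP i) => {}i ->; case: (split_ordP j) => {}j ->.
  + by rewrite block_mxEul !ord1 M1 mxE eqxx.
  + by rewrite block_mxEur !ord1 M1 (inj_eq (@rshift_inj _ _)) eq_rlshift mxE.
  + by rewrite block_mxEdl !ord1 mxE.
  + by rewrite block_mxEdr !mxE.
Qed.

Lemma block3P (F : fieldType) (n : nat) (hn : (2 <= n)%N) (o0 o1 : 'I_n)
    (p q s : F) (M : 'M[F]_n) :
  o0 = 0%N :> nat -> o1 = 1%N :> nat ->
  (exists c C, M = block3 hn p q s c C) <->
  [/\ forall j, M o0 j = p *+ (j == o0) + q *+ (j == o1),
      forall j, M o1 j = s *+ (j == o1)
    & forall i, M i o0 = p *+ (i == o0)].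
Proof.
case: n hn o0 o1 M => [|[|m]] // hm o0 o1 M v0 v1.
have -> : o0 = lshift (1 + m) (ord0 : 'I_1) by apply: val_inj.
have -> : o1 = rshift 1 (lshift m (ord0 : 'I_1)) by apply: val_inj.
split=> [[c [C ->]]|/(proj2 (block_mx112P p q s M))[c [C ->]]].
  by apply/(proj1 (block_mx112P p q s _)); exists c, C; rewrite block3E.
by exists c, C; rewrite block3E.
Qed.

Lemma det_block3 (F : fieldType) (n : nat) (hn : (2 <= n)%N) (p q s : F) c C :
  \det (block3 hn p q s c C) = p * (s * \det C).
Proof.
case: n hn c C => [|[|m]] // hm c C.
by rewrite block3E (@det_ublock _ 1 (1 + m)) (@det_lblock _ 1 m) !det_scalar1.
Qed.

(* Equations fixing some of the entries have as differentials distinct vectors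
   of the standard dual basis. *)
Lemma lie_subgroup_entries (F : fieldType) (n : nat) (G : 'M[F]_n -> Prop)
    (S : {set 'I_n * 'I_n}) (N : 'M[F]_n) :
  GL_subgroup G ->
  (forall M, M \in unitmx -> (G M <-> {in S, forall u, M u.1 u.2 = N u.1 u.2})) ->
  lie_subgroup G.
Proof.
move=> gG GE; split=> //.
(* One equation per position in [S]; [ix k] is the index of that position in the vectorised
   matrix. *)
pose u (k : 'I_#|S|) := enum_val k; pose ix (k : 'I_#|S|) := mxvec_index (u k).1 (u k).2.
have ix_inj : injective ix.
  move=> k k' /cast_ord_inj /enum_rank_inj.
  by rewrite -!surjective_pairing => /enum_val_inj.
exists #|S|, (fun k => 'X_(ix k) - (N (u k).1 (u k).2)%:MP); split=> M.
  move=> uM; apply: iff_trans (GE M uM) _; split=> [MN k|MN v Sv].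
    by rewrite mevalB mevalXU mevalC mxvecE MN ?subrr ?enum_valP.
  have := MN (enum_rank_in Sv v).
  rewrite mevalB mevalXU mevalC mxvecE /u enum_rankK_in //.
  by move/eqP; rewrite subr_eq0 => /eqP.
move=> _; set A := \matrix_(_, _) _.
have AE k l : A k l = (l == ix k)%:R.
  rewrite mxE mderivB mderivC subr0 mderivX mevalZ.
  rewrite mnm1E eq_sym; case: eqP => [->|_]; last by rewrite mul0r.
  by rewrite -{1}[U_(_)%MM]add0m addmK mpolyX0 meval1 mulr1.
(* The rows of [A] are pairwise distinct standard basis vectors, so [A^T] is a right inverse. *)
apply/row_freeP; exists A^T; apply/matrixP=> k k'.
rewrite mxE (bigD1 (ix k)) //= big1 => [|l ne]; last first.
  by rewrite AE (negbTE ne) mul0r.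
by rewrite [A^T _ _]mxE !AE eqxx mul1r addr0 (inj_eq ix_inj) mxE.
Qed.

(** * Endomorphisms and their matrices in a fixed basis *)

Section Basis.
Variables (F : fieldType) (L : vectType F) (n : nat) (B : n.-tuple L).
Hypothesis basB : basis_of fullv B.

Let freeB : free B := basis_free basB.

Lemma coord_inj (x y : L) : (forall i, coord B i x = coord B i y) -> x = y.
Proof.
move=> e; rewrite (coord_basis basB (memvf x)) (coord_basis basB (memvf y)).
by apply: eq_bigr => i _; rewrite e.
Qed.

(** Stated for a bare function so that it applies to the partial maps [br x] and [br^~ y], which
    carry no bundled linear structure. *)
Lemma linear_basis (g : L -> L) : linear g ->
  forall x, g x = \sum_i coord B i x *: g B`_i.
Proof.
move=> gl x; pose G : {linear L -> L} := HB.pack g (GRing.isLinear.Build F L L *:%R g gl).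
rewrite -[g]/(G : L -> L) {1}(coord_basis basB (memvf x)) linear_sum.
by apply: eq_bigr => i _; rewrite linearZ.
Qed.

Lemma coord_lfun (f : 'End(L)) i x :
  coord B i (f x) = \sum_j mx_of B f i j * coord B j x.
Proof.
rewrite {1}(coord_basis basB (memvf x)) !linear_sum /=.
by apply: eq_bigr => j _; rewrite !linearZ mxE mulrC.
Qed.

Lemma mx_of_inj : injective (mx_of B).
Proof.
move=> f g e; apply/lfunP=> x; apply: coord_inj => i.
by rewrite !coord_lfun e.
Qed.

Lemma mx_of_surj (M : 'M[F]_n) : exists f, mx_of B f = M.
Proof.
pose g (x : L) := \sum_j coord B j x *: \sum_i M i j *: B`_i.
have gl : linear g.
  move=> c x y; rewrite /g scaler_sumr -big_split; apply: eq_bigr => j _.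
  by rewrite linearP /= scalerDl scalerA.
pose G : {linear L -> L} := HB.pack g (GRing.isLinear.Build F L L *:%R g gl).
have gB (j : 'I_n) : g B`_j = \sum_i M i j *: B`_i.
  rewrite [LHS](bigD1 j) //= coord_free // eqxx scale1r.
  rewrite [X in _ + X]big1 ?addr0 // => k nk.
  by rewrite coord_free // eq_sym (negbTE nk) scale0r.
exists (linfun G); apply/matrixP=> i j; rewrite mxE lfunE /= gB.
rewrite linear_sum (bigD1 i) //= big1 => [|k nk].
  by rewrite linearZ /= coord_free // eqxx mulr1 addr0.
by rewrite linearZ /= coord_free // (negbTE nk) mulr0.
Qed.

Lemma mx_of_comp (f g : 'End(L)) : mx_of B (f \o g)%VF = mx_of B f *m mx_of B g.
Proof.
apply/matrixP=> i j; rewrite !mxE comp_lfunE coord_lfun.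
by apply: eq_bigr => k _; rewrite [mx_of B g _ _]mxE.
Qed.

Lemma mx_of1 : mx_of B \1%VF = 1%:M.
Proof. by apply/matrixP=> i j; rewrite !mxE id_lfunE coord_free // eq_sym. Qed.

Lemma mx_of_invf (f : 'End(L)) : bijective f ->
  mx_of B f \in unitmx /\ mx_of B f^-1%VF = invmx (mx_of B f).
Proof.
move=> bf; have kf : lker f == 0%VS by apply/lker0P/bij_inj.
(* With trivial kernel, [f^-1%VF] is a left inverse of [f]; for square matrices a left inverse is
   two-sided. *)
have e : mx_of B f^-1%VF *m mx_of B f = 1%:M.
  by rewrite -mx_of_comp (lker0_compVf kf) mx_of1.
have [_ uf] := mulmx1_unit e; split=> //.
by rewrite -[LHS]mulmx1 -(mulmxV uf) mulmxA e mul1mx.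
Qed.

Lemma mx_of_bijective (f : 'End(L)) : bijective f <-> mx_of B f \in unitmx.
Proof.
split=> [/mx_of_invf[]//|uf]; have [g eg] := mx_of_surj (invmx (mx_of B f)).
exists g => x; rewrite -comp_lfunE.
  suff -> : (g \o f)%VF = \1%VF :> 'End(L) by rewrite id_lfunE.
  by apply: mx_of_inj; rewrite mx_of_comp mx_of1 eg mulVmx.
suff -> : (f \o g)%VF = \1%VF :> 'End(L) by rewrite id_lfunE.
by apply: mx_of_inj; rewrite mx_of_comp mx_of1 eg mulmxV.
Qed.

End Basis.

(** * The Leibniz algebra of biderivations of a bilinear bracket *)

Section Biderivations.
Variables (F : fieldType) (L : vectType F) (br : L -> L -> L).
Hypothesis linl : forall z, linear (br^~ z).
Hypothesis linr : forall z, linear (br z).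

Let brl (c : F) x y z : br (c *: x + y) z = c *: br x z + br y z := linl z c x y.
Let brr (c : F) x y z : br z (c *: x + y) = c *: br z x + br z y := linr z c x y.
Let brBl x y z : br (x - y) z = br x z - br y z.
Proof. by rewrite addrC -scaleN1r brl scaleN1r addrC. Qed.
Let brBr x y z : br z (x - y) = br z x - br z y.
Proof. by rewrite addrC -scaleN1r brr scaleN1r addrC. Qed.
Let br0l z : br 0 z = 0.
Proof. by have := brBl 0 0 z; rewrite !subrr. Qed.
Let br0r z : br z 0 = 0.
Proof. by have := brBr 0 0 z; rewrite !subrr. Qed.

(** Comparing coordinates in some basis turns an identity between linear combinations of vectors
    into a scalar identity, which [ring] decides. *)
Ltac coordinatewise := apply: (coord_inj (vbasisP fullv)) => i;
  rewrite ?(linearD, linearN, linearZ) /=; ring.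

Lemma derivation_commutator d d' : derivation br d -> derivation br d' ->
  derivation br ((d \o d')%VF - (d' \o d)%VF).
Proof.
move=> dd dd' x y; do !rewrite lfunE /=.
by rewrite dd dd' !linearD /= !dd !dd' brBl brBr; coordinatewise.
Qed.

(** Both composites produce the mixed terms $[d x, D y]$ and $-[d y, D x]$, which cancel in the
    difference. *)
Lemma antiderivation_commutator d D : derivation br d -> antiderivation br D ->
  antiderivation br ((d \o D)%VF - (D \o d)%VF).
Proof.
move=> dd aD x y; do !rewrite lfunE /=.
rewrite aD dd linearB linearD /= !dd !aD !brBr; coordinatewise.
Qed.

Lemma biderivation_leibniz :
  left_leibniz_on (biderivation br) (@bider_bracket F L).
Proof.
split.
- split=> [|c p q [p1 p2 p3] [q1 q2 q3]]; first by split=> x y; do !rewrite lfunE /=;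
    rewrite ?br0l ?br0r ?subr0 ?addr0 ?br0l.
  split=> x y; do !rewrite lfunE /=.
  + by rewrite p1 q1 brl brr; coordinatewise.
  + by rewrite p2 q2 !brr; coordinatewise.
  + by rewrite addrACA -scalerDr brl p3 q3 scaler0 addr0.
- move=> [d D] [d' D'] [/= p1 p2 p3] [/= q1 q2 q3]; split=> [||x y] /=.
  + exact: derivation_commutator.
  + exact: antiderivation_commutator.
  + do !rewrite lfunE /=.
    (* In this grouping, the second term is $d' + D'$ applied to $d x$, so it multiplies to zero
       from the left. For the first, apply the derivation $d$ to $[d' x + D' x, y] = 0$. *)
    have -> : d (d' x) - d' (d x) + (d (D' x) - D' (d x)) =
              d (d' x + D' x) - (d' (d x) + D' (d x)).
      by coordinatewise.
    rewrite brBl q3 subr0; have := p1 (d' x + D' x) y.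
    by rewrite !q3 linear0 addr0 => <-.
(* Bilinearity, and below it the Leibniz identity, hold for arbitrary pairs of endomorphisms. *)
- move=> c [d D] [d' D'] [d'' D''] _ _ _; split; congr pair => /=;
    apply/lfunP=> x; do !rewrite lfunE /=; rewrite !linearD !linearZ /=;
    coordinatewise.
- move=> [d D] [d' D'] [d'' D''] _ _ _; congr pair => /=;
    apply/lfunP=> x; do !rewrite lfunE /=; rewrite !linearB /=; coordinatewise.
Qed.

End Biderivations.

(** * Automorphisms form a group of matrices *)

Section Automorphisms.
Variables (F : fieldType) (L : vectType F) (br : L -> L -> L).

Lemma automorphism1 : automorphism br \1%VF.
Proof.
split=> [|x y]; last by rewrite !id_lfunE.
by exists id => x; rewrite id_lfunE.
Qed.

Lemma automorphism_comp phi psi :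
  automorphism br phi -> automorphism br psi -> automorphism br (phi \o psi)%VF.
Proof.
move=> [b1 m1] [b2 m2]; split=> [|x y]; last by rewrite !comp_lfunE m2 m1.
by apply: (eq_bij (bij_comp b1 b2)) => x; rewrite comp_lfunE.
Qed.

Lemma automorphism_inv phi : automorphism br phi -> automorphism br phi^-1%VF.
Proof.
move=> [b1 m1]; have k : lker phi == 0%VS by apply/lker0P/bij_inj.
split=> [|x y]; first by exists phi; [exact: lker0_lfunVK | exact: lker0_lfunK].
by apply: (bij_inj b1); rewrite m1 !lker0_lfunVK.
Qed.

Lemma aut_mx_GL n (B : n.-tuple L) : basis_of fullv B -> GL_subgroup (aut_mx br B).
Proof.
move=> basB; split=> [M [f [bf _] <-]||M N [f af <-] [g ag <-]|M [f af <-]].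
- exact/(mx_of_bijective basB).
- by exists \1%VF; [exact: automorphism1 | exact: mx_of1].
- by exists (f \o g)%VF; [exact: automorphism_comp | exact: mx_of_comp].
- exists f^-1%VF; first exact: automorphism_inv.
  by case: (mx_of_invf basB (proj1 af)).
Qed.

End Automorphisms.

(** * Derivations, biderivations and automorphisms of $L_n$ *)

Section Ln.
Variables (F : fieldType) (n : nat) (hn : (2 <= n)%N) (L : vectType F).
Variables (br : L -> L -> L) (B : n.-tuple L).
Hypothesis hL : is_Ln br B.

(** Indices are 0-based: below, [e0] and [e1] are the basis vectors $e_1$ and $e_2$, and [x0], [x1]
    are the coordinates along them. *)
Variables (o0 o1 : 'I_n).
Hypotheses (v0 : o0 = 0%N :> nat) (v1 : o1 = 1%N :> nat).
Let basB : basis_of fullv B. Proof. by case: hL. Qed.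
Let freeB : free B. Proof. exact: basis_free basB. Qed.
Local Notation x0 := (coord B o0).
Local Notation x1 := (coord B o1).
Local Notation e0 := B`_o0.
Local Notation e1 := B`_o1.

Let coordB (i j : 'I_n) : coord B i B`_j = (i == j)%:R.
Proof. by rewrite coord_free // eq_sym. Qed.

Let x00 : x0 e0 = 1. Proof. by rewrite coordB eqxx. Qed.
Let x11 : x1 e1 = 1. Proof. by rewrite coordB eqxx. Qed.
Let n01 : (o1 == o0) = false. Proof. by rewrite -val_eqE /= v0 v1. Qed.
Let x01 : x0 e1 = 0. Proof. by rewrite coordB eq_sym n01. Qed.
Let x10 : x1 e0 = 0. Proof. by rewrite coordB n01. Qed.
Let coordE := (x00, x01, x10, x11).

Let e0_neq0 : e0 != 0.
Proof.
apply: contra_neq (oner_neq0 F) => e.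
by have := x00; rewrite e linear0 => /esym.
Qed.

(** All brackets are multiples of [e0], so this turns bracket identities into scalar ones. *)
Let e0_inj : injective ( *:%R^~ e0).
Proof.
move=> c c' /eqP; rewrite -subr_eq0 -scalerBl scaler_eq0 (negbTE e0_neq0) orbF.
by rewrite subr_eq0 => /eqP.
Qed.

Lemma Ln_linl z : linear (br^~ z).
Proof. by case: hL => -[_ _ h _] _ _ _ c x y; case: (h c x y z I I I). Qed.

Lemma Ln_linr z : linear (br z).
Proof. by case: hL => -[_ _ h _] _ _ _ c x y; case: (h c x y z I I I). Qed.

Lemma Ln_bracket x y : br x y = (x1 x * x0 y) *: e0.
Proof.
case: hL => _ _ br10 br0.
rewrite (linear_basis basB (Ln_linl y)) (bigD1 o1) //= big1 ?addr0 => [|i ni].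
  rewrite (linear_basis basB (Ln_linr _)) (bigD1 o0) //= big1 ?addr0 => [|j nj].
    by rewrite v0 v1 br10 scalerA.
  by rewrite (br0 o1 j) ?scaler0 // => -[_]; apply/eqP; rewrite -v0.
rewrite (linear_basis basB (Ln_linr _)) big1 ?scaler0 // => j _.
by rewrite (br0 i j) ?scaler0 // => -[/eqP]; rewrite -v1 (inj_eq val_inj) (negbTE ni).
Qed.

(** Coordinate-free reading of the shape: the first two rows describe [x0] and [x1] after [f], and
    the first column describes [f e0]. The characterisations below are proved in this form. *)
Lemma mx_of_block3P (f : 'End(L)) (p q s : F) :
  (exists c C, mx_of B f = block3 hn p q s c C) <->
  [/\ forall x, x0 (f x) = p * x0 x + q * x1 x,
      forall x, x1 (f x) = s * x1 x
    & f e0 = p *: e0].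
Proof.
apply: iff_trans (block3P hn p q s (mx_of B f) v0 v1) _.
split=> [[M0 M1 Mc]|[f0 f1 fe]]; split=> [x|x|].
- rewrite (coord_lfun basB) (bigD1 o0) //= (bigD1 o1) ?n01 //=.
  rewrite big1 => [|j /andP[nj0 nj1]].
    by rewrite !M0 !eqxx eq_sym n01 addr0 add0r addr0.
  by rewrite M0 (negbTE nj0) (negbTE nj1) addr0 mul0r.
- rewrite (coord_lfun basB) (bigD1 o1) //= big1 => [|j nj].
    by rewrite M1 eqxx addr0.
  by rewrite M1 (negbTE nj) mul0r.
- apply: (coord_inj basB) => i.
  by have := Mc i; rewrite mxE => ->; rewrite linearZ /= coordB mulr_natr.
- by rewrite mxE f0 !coordB !mulr_natr ![x == _]eq_sym.
- by rewrite mxE f1 coordB mulr_natr eq_sym.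
- by move=> i; rewrite mxE fe linearZ /= coordB mulr_natr.
Qed.

Lemma Ln_derivationP (d : 'End(L)) : derivation br d <->
  exists alpha a A, mx_of B d = block3 hn alpha 0 0 a A.
Proof.
split=> [dd|[alpha /mx_of_block3P[d0 d1 de]] x y]; last first.
  rewrite !Ln_bracket linearZ /= de d0 d1 scalerA -scalerDl; congr (_ *: _); ring.
have h x y : d (br x y) = (x1 (d x) * x0 y + x1 x * x0 (d y)) *: e0.
  by rewrite dd !Ln_bracket scalerDl.
(* The eigenvalue of [d] at [e0], read off from [br e1 e0 = e0]. *)
pose al := x1 (d e1) + x0 (d e0).
have de : d e0 = al *: e0.
  by have := h e1 e0; rewrite Ln_bracket !coordE !mul1r scale1r mulr1.
have k x y : x1 x * x0 y * al = x1 (d x) * x0 y + x1 x * x0 (d y).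
  apply: e0_inj.
  by rewrite -h Ln_bracket linearZ /= de scalerA.
(* At [y = e0] the identity [k] has [x1 x * al] on both sides, leaving only [x1 (d x)]. *)
have d1 x : x1 (d x) = 0.
  have := k x e0; rewrite de linearZ /= !coordE !mulr1 => /eqP.
  by rewrite -subr_eq subrr => /eqP.
exists al; apply/mx_of_block3P; split=> [x|x|//]; last by rewrite mul0r.
by have := k e1 x; rewrite d1 coordE !mul1r mul0r add0r mul0r addr0 mulrC.
Qed.

(** The vanishing of [x1 (D x)] is added because the anti-derivation identity does not imply it; for
    biderivations it comes from $[d x + D x, y] = 0$. *)
Lemma Ln_antiderivationP (D : 'End(L)) :
  antiderivation br D /\ (forall x, x1 (D x) = 0) <->
  exists alpha a A, mx_of B D = block3 hn 0 alpha 0 a A.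
Proof.
split=> [[aD D1]|[alpha /mx_of_block3P[D0 D1 De]]]; last first.
  split=> [x y|x]; last by rewrite D1 mul0r.
  rewrite !Ln_bracket linearZ /= De -scalerBl !D0 !scale0r scaler0.
  by rewrite -[LHS](scale0r e0); congr (_ *: _); ring.
have h x y : D (br x y) = (x1 x * x0 (D y) - x1 y * x0 (D x)) *: e0.
  by rewrite aD !Ln_bracket scalerBl.
have De : D e0 = x0 (D e0) *: e0.
  by have := h e1 e0; rewrite Ln_bracket !coordE mul0r subr0 !mul1r scale1r.
have k x y : x1 x * x0 y * x0 (D e0) = x1 x * x0 (D y) - x1 y * x0 (D x).
  by apply: e0_inj; rewrite -h Ln_bracket linearZ /= {2}De scalerA.
(* The bracket in the opposite order, [br e0 e1], is zero, which forces the eigenvalue at [e0] to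
   vanish. *)
have De0 : x0 (D e0) = 0.
  have := k e0 e1; rewrite !coordE !mul0r sub0r mul1r => /eqP.
  by rewrite eq_sym oppr_eq0 => /eqP.
exists (x0 (D e1)); apply/mx_of_block3P; split=> [x|x|].
- have := k e1 x; rewrite De0 mulr0 coordE mul1r => /esym/eqP.
  by rewrite subr_eq0 => /eqP ->; ring.
- by rewrite D1 mul0r.
- by rewrite De De0.
Qed.

Lemma Ln_biderivationP (d D : 'End(L)) : biderivation br (d, D) <->
  exists alpha alpha' a a' A A',
    mx_of B d = block3 hn alpha 0 0 a A /\ mx_of B D = block3 hn 0 alpha' 0 a' A'.
Proof.
split=> [[/= dd aD dD]|[al [al' [a [a' [A [A' [ed eD]]]]]]]]; last first.
  have /mx_of_block3P[_ d1 _] : exists a A, mx_of B d = block3 hn al 0 0 a A.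
    by exists a, A.
  have [aD D1] : antiderivation br D /\ (forall x, x1 (D x) = 0).
    by apply/Ln_antiderivationP; exists al', a', A'.
  split=> //=; first by apply/Ln_derivationP; exists al, a, A.
  by move=> x y; rewrite Ln_bracket linearD /= d1 D1 mul0r addr0 mul0r scale0r.
have /Ln_derivationP[al [a [A ed]]] := dd.
have /mx_of_block3P[_ d1 _] : exists a A, mx_of B d = block3 hn al 0 0 a A.
  by exists a, A.
(* Taking [y = e0] gives [x1 (d x + D x) = 0], and the [d] part already vanishes. *)
have D1 x : x1 (D x) = 0.
  have /eqP := dD x e0; rewrite Ln_bracket linearD /= d1 mul0r add0r coordE mulr1.
  by rewrite scaler_eq0 (negbTE e0_neq0) orbF => /eqP.
have /Ln_antiderivationP[al' [a' [A' eD]]] := conj aD D1.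
by exists al, al', a, a', A, A'.
Qed.

Lemma Ln_automorphismP (f : 'End(L)) : automorphism br f <->
  bijective f /\ exists beta b C, mx_of B f = block3 hn beta 0 1 b C.
Proof.
split=> -[bf]; last first.
  case=> be /mx_of_block3P[f0 f1 fe]; split=> // x y.
  by rewrite !Ln_bracket linearZ /= fe scalerA f0 f1; congr (_ *: _); ring.
move=> fM; split=> //.
have h x y : f (br x y) = (x1 (f x) * x0 (f y)) *: e0 by rewrite fM Ln_bracket.
pose t := x1 (f e1) * x0 (f e0).
have fe : f e0 = t *: e0.
  by have := h e1 e0; rewrite Ln_bracket !coordE !mul1r scale1r.
have f00 : x0 (f e0) = t by rewrite fe linearZ /= coordE mulr1.
(* Otherwise the injective map [f] would kill [e0]. *)
have t0 : t != 0.
  apply: contra_neq e0_neq0 => t0; apply: (bij_inj bf).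
  by rewrite fe t0 scale0r linear0.
(* Since [x0 (f e0) = t], the definition of [t] reads [t = x1 (f e1) * t]; cancel [t]. *)
have f11 : x1 (f e1) = 1 by apply: (mulIf t0); rewrite mul1r -[in LHS]f00.
have k x y : x1 x * x0 y * t = x1 (f x) * x0 (f y).
  by apply: e0_inj; rewrite -h Ln_bracket linearZ /= fe scalerA.
exists t; apply/mx_of_block3P; split=> [x|x|//].
  by have := k e1 x; rewrite coordE f11 !mul1r mul0r addr0 mulrC.
by apply: (mulIf t0); have := k x e0; rewrite f00 coordE mulr1 mul1r.
Qed.

Lemma Ln_aut_mxP (M : 'M[F]_n) : aut_mx br B M <->
  M \in unitmx /\ exists beta b C, M = block3 hn beta 0 1 b C.
Proof.
split=> [[f /Ln_automorphismP[bf bl] <-]|[uM bl]].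
  by split=> //; apply/(mx_of_bijective basB).
have [f ef] := mx_of_surj basB M; exists f => //.
apply/Ln_automorphismP; rewrite ef; split=> //.
by apply/(mx_of_bijective basB); rewrite ef.
Qed.

Lemma Ln_aut_mxE (M : 'M[F]_n) : aut_mx br B M <->
  exists beta b C, [/\ beta != 0, C \in unitmx & M = block3 hn beta 0 1 b C].
Proof.
(* The determinant of this block matrix is [be * \det C]. *)
have u be b C : (block3 hn be 0 1 b C \in unitmx) = (be != 0) && (C \in unitmx).
  by rewrite !unitmxE !unitfE det_block3 mul1r mulf_eq0 negb_or.
apply: iff_trans (Ln_aut_mxP M) _.
split=> [[uM [be [b [C eM]]]]|[be [b [C [be0 uC ->]]]]].
  by move: uM; rewrite eM u => /andP[be0 uC]; exists be, b, C.
by rewrite u be0 uC; split=> //; exists be, b, C.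
Qed.

Lemma Ln_aut_lie_subgroup : lie_subgroup (aut_mx br B).
Proof.
(* The prescribed positions are the whole row [o1] together with row and column [o0], except the
   corner, which the exclusive or leaves free for [beta]. The prescribed values are the entries of
   the identity matrix. *)
pose S := [set u : 'I_n * 'I_n | (u.1 == o1) || ((u.1 == o0) (+) (u.2 == o0))].
apply: (@lie_subgroup_entries _ _ _ S 1%:M (aut_mx_GL br basB)) => M uM.
apply: iff_trans (Ln_aut_mxP M) _.
have P be := block3P hn be 0 1 M v0 v1.
split=> [[_ [be /P[M0 M1 Mc]]] [i j]|MS].
  rewrite inE /= mxE => /orP[/eqP ->|]; first by rewrite M1 eq_sym.
  case: (i =P o0) => [->|/eqP ni] /=; last by move=> /eqP ->; rewrite Mc (negbTE ni).
  by move=> nj; rewrite M0 (negbTE nj) mul0rn addr0 eq_sym (negbTE nj).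
have MSE i j : (i == o1) || ((i == o0) (+) (j == o0)) -> M i j = (i == j)%:R.
  by move=> s; have := MS (i, j); rewrite inE mxE => /(_ s).
split=> //; exists (M o0 o0); apply/P; split=> [j|j|i].
- rewrite mul0rn addr0; have [->//|nj] := eqVneq j o0.
  by rewrite (MSE o0 j) ?eqxx ?(negbTE nj) ?orbT // eq_sym (negbTE nj).
- by rewrite MSE ?eqxx // eq_sym.
- have [->//|ni] := eqVneq i o0.
  by rewrite (MSE i o0) ?eqxx ?(negbTE ni) ?orbT.
Qed.

End Ln.

Theorem theorem2p4 (F : fieldType) (hchar : 2%N \notin [pchar F])
    (n : nat) (hn : (2 <= n)%N)
    (L : vectType F) (br : L -> L -> L) (B : n.-tuple L) (hL : is_Ln br B) :
  [/\
    (* (i) *)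
    forall d : 'End(L), derivation br d <->
      exists (alpha : F) (a : 'cV[F]_(n.-2)) (A : 'M[F]_(n.-2)),
        mx_of B d = block3 hn alpha 0 0 a A,
    (* (ii) *)
    [/\ forall phi psi : 'End(L),
          automorphism br phi -> automorphism br psi ->
          automorphism br (phi \o psi)%VF /\
          mx_of B (phi \o psi)%VF = mx_of B phi *m mx_of B psi,
        forall phi psi : 'End(L),
          automorphism br phi -> automorphism br psi ->
          mx_of B phi = mx_of B psi -> phi = psi,
        lie_subgroup (aut_mx br B)
      & forall M : 'M[F]_n, aut_mx br B M <->
          exists (beta : F) (b : 'cV[F]_(n.-2)) (C : 'M[F]_(n.-2)),
            [/\ beta != 0, C \in unitmx & M = block3 hn beta 0 1 b C]]
    & (* (iii) *)
    left_leibniz_on (biderivation br) (@bider_bracket F L) /\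
    forall d D : 'End(L), biderivation br (d, D) <->
      exists (alpha alpha' : F) (a a' : 'cV[F]_(n.-2)) (A A' : 'M[F]_(n.-2)),
        mx_of B d = block3 hn alpha 0 0 a A /\
        mx_of B D = block3 hn 0 alpha' 0 a' A'].
Proof.
pose o0 : 'I_n := Ordinal (ltnW hn); pose o1 : 'I_n := Ordinal hn.
have v0 : o0 = 0%N :> nat by []. have v1 : o1 = 1%N :> nat by [].
have basB : basis_of fullv B by case: hL.
split.
- exact: (Ln_derivationP hn hL v0 v1).
- split.
  + move=> f g af ag; split; first exact: automorphism_comp.
    exact: mx_of_comp.
  + by move=> f g _ _; apply: mx_of_inj.
  + exact: (Ln_aut_lie_subgroup hn hL v0 v1).
  + exact: (Ln_aut_mxE hn hL v0 v1).
- split; last exact: (Ln_biderivationP hn hL v0 v1).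
  exact: biderivation_leibniz (Ln_linl hL) (Ln_linr hL).
Qed.
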